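(* Let $E$ be a sharply dominating atomic Archimedean lattice effect algebra. Let $\mathrm{T}(E)$ be the subset of $\mathrm{S}(E)\times\mathrm{M}(E)$ given by $$\mathrm{T}(E)=\{(z_S,z_M)\in\mathrm{S}(E)\times\mathrm{M}(E)\mid z_M\in h(z_S')\}.$$ Equip $\mathrm{T}(E)$ with a partial binary operation $\oplus_{\mathrm{T}(E)}$ such that $(x_S,x_M)\oplus_{\mathrm{T}(E)}(y_S,y_M)$ is defined if and only if (i) $S(x_M,y_M)$ is defined, (ii) $z_S=x_S\oplus_{\mathrm{S}(E)}y_S\oplus_{\mathrm{S}(E)}S(x_M,y_M)$ is defined, (iii) $z_M=\big(x_M\ominus_{\mathrm{M}(E)}(S(x_M,y_M)\wedge x_M)\big)\oplus_{\mathrm{M}(E)}\big(y_M\ominus_{\mathrm{M}(E)}(S(x_M,y_M)\wedge y_M)\big)$ is defined, (iv) $z_M\in h(z_S')$. In this case $(z_S,z_M)=(x_S,x_M)\oplus_{\mathrm{T}(E)}(y_S,y_M)$. Let $0_{\mathrm{T}(E)}=(0_E,0_E)$ and $1_{\mathrm{T}(E)}=(1_E,0_E)$. Then $(\mathrm{T}(E),\oplus_{\mathrm{T}(E)},0_{\mathrm{T}(E)},1_{\mathrm{T}(E)})$ is an effect algebra and the mapping $\varphi:E\to\mathrm{T}(E)$ given by $\varphi(x)=(\widetilde{x},x\ominus_E\widetilde{x})$ is an isomorphism of effect algebras.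
   Context: An effect algebra is a partial algebra $(E;\oplus,0,1)$ with $0\ne 1$ and a partially defined binary operation $\oplus$ such that for all $x,y,z\in E$: (Ei) $x\oplus y=y\oplus x$ if $x\oplus y$ is defined; (Eii) $(x\oplus y)\oplus z=x\oplus(y\oplus z)$ if one side is defined; (Eiii) for every $x$ there is a unique $y$ with $x\oplus y=1$ (write $x'=y$); (Eiv) if $1\oplus x$ is defined then $x=0$. Put $x\le y$ and $y\ominus x=z$ iff $x\oplus z$ is defined and equals $y$; $\le$ is a partial order. $E$ is a lattice effect algebra if $(E,\le)$ is a lattice. For $x\in E$, $\mathrm{ord}(x)$ is the greatest positive integer $n$ for which $nx=x\oplus\cdots\oplus x$ ($n$ times) exists, and $\infty$ if all $nx$ exist; $E$ is Archimedean if $\mathrm{ord}(x)<\infty$ for all nonzero $x\in E$. An atom is a minimal nonzero element; $E$ is atomic if below every nonzero element there is an atom. Sharp elements: $\mathrm{S}(E)=\{x\in E\mid x\wedge x'=0\}$. $E$ is sharply dominating if for every $x\in E$ there is a smallest sharp element $\widehat{x}\in\mathrm{S}(E)$ with $x\le\widehat{x}$; equivalently, for every $x$ there is a greatest sharp element $\widetilde{x}\in\mathrm{S}(E)$ with $\widetilde{x}\le x$. For such lattice $E$, $\mathrm{S}(E)$ is a sub-lattice effect algebra of $E$, with inherited operation $\oplus_{\mathrm{S}(E)}$. Meager elements: $\mathrm{M}(E)=\{x\in E\mid \text{if }v\in\mathrm{S}(E)\text{ and }v\le x\text{ then }v=0\}$. On $\mathrm{M}(E)$: $x\oplus_{\mathrm{M}(E)}y$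 exists iff $x\oplus_E y$ exists and lies in $\mathrm{M}(E)$, in which case $x\oplus_{\mathrm{M}(E)}y=x\oplus_E y$; $\mathrm{M}(E)$ is a generalized effect algebra, it is a down-set of $E$, and $x\ominus_{\mathrm{M}(E)}y=x\ominus_E y$ for $y\le x$ in $\mathrm{M}(E)$. The map $h:\mathrm{S}(E)\to 2^{\mathrm{M}(E)}$ is $h(s)=\{x\in\mathrm{M}(E)\mid x\le s\}$. The partial map $S:\mathrm{M}(E)\times\mathrm{M}(E)\to\mathrm{S}(E)$: $S(x,y)$ is defined iff the set $\mathscr{S}(x,y)=\{z\in\mathrm{S}(E)\mid z=(z\wedge x)\oplus_E(z\wedge y)\}$ has a top element $z_0\in\mathscr{S}(x,y)$, in which case $S(x,y)=z_0$. An isomorphism of effect algebras is a bijection $f$ preserving $0$ and $1$ such that $x\oplus y$ is defined iff $f(x)\oplus f(y)$ is defined, in which case $f(x\oplus y)=f(x)\oplus f(y)$. *)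

(* Defs.v *)
From Stdlib Require Import ClassicalEpsilon.
From Stdlib Require Export FinFun.

Set Implicit Arguments.
Unset Strict Implicit.
Unset Printing Implicit Defensive.

(* A partial binary operation on T is a functional ternary relation op:
   op x y z reads "x (+) y is defined and equals z". *)
Definition defined (T : Type) (op : T -> T -> T -> Prop) (x y : T) : Prop :=
  exists z, op x y z.

Record is_effect_algebra (T : Type) (op : T -> T -> T -> Prop) (o i : T)
    : Prop := {
  ea_functional : forall x y z z', op x y z -> op x y z' -> z = z';
  ea_nontrivial : o <> i;
  ea_comm : forall x y z, op x y z -> op y x z;
  ea_assoc : forall x y z w,
    (exists u, op x y u /\ op u z w) <-> (exists v, op y z v /\ op x v w);
  ea_compl : forall x, exists! y, op x y i;
  ea_one : forall x, defined op i x -> x = o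
}.

Definition is_ea_isomorphism (A B : Type)
    (opA : A -> A -> A -> Prop) (oA iA : A)
    (opB : B -> B -> B -> Prop) (oB iB : B) (f : A -> B) : Prop :=
  Bijective f /\ f oA = oB /\ f iA = iB /\
  (forall x y, defined opA x y <-> defined opB (f x) (f y)) /\
  (forall x y z, opA x y z -> opB (f x) (f y) (f z)).

Record effect_algebra : Type := {
  carrier :> Type;
  oplus : carrier -> carrier -> carrier -> Prop;
  zero : carrier;
  one : carrier;
  effect_algebraP : is_effect_algebra oplus zero one
}.
Arguments zero {e}.
Arguments one {e}.

Section EffectAlgebra.
Variable E : effect_algebra.
Implicit Types x y z a n : E.

Definition le x y : Prop := exists z, oplus x z y.

(* ominus x y z: x (-) y is defined and equals z. *)
Definition ominus x y z : Prop := oplus y z x.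

Definition compl x : E :=
  proj1_sig (constructive_definite_description _
    (ea_compl (effect_algebraP E) x)).

Definition is_meet x y m : Prop :=
  le m x /\ le m y /\ forall z, le z x -> le z y -> le z m.

Definition is_join x y j : Prop :=
  le x j /\ le y j /\ forall z, le x z -> le y z -> le j z.

(* multiple x n y: the n-fold sum x (+) ... (+) x exists and equals y. *)
Inductive multiple x : nat -> E -> Prop :=
| multiple_one : multiple x 1 x
| multiple_succ k y z : multiple x k y -> oplus y x z -> multiple x (S k) z.

(* has_finite_ord x k: ord(x) = k; ord(x) is infinite if there is no such k. *)
Definition has_finite_ord x (k : nat) : Prop :=
  (exists y, multiple x k y) /\
  forall m, (exists y, multiple x m y) -> m <= k.

Definition archimedean : Prop :=
  forall x, x <> zero -> exists k, has_finite_ord x k.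

Definition atom a : Prop :=
  a <> zero /\ forall x, x <> zero -> le x a -> x = a.

Definition atomic : Prop :=
  forall x, x <> zero -> exists a, atom a /\ le a x.

End EffectAlgebra.

Record lattice_effect_algebra : Type := {
  lea_ea :> effect_algebra;
  lea_meet : forall x y : lea_ea, exists m, is_meet x y m;
  lea_join : forall x y : lea_ea, exists j, is_join x y j
}.

Section LatticeEffectAlgebra.
Variable E : lattice_effect_algebra.
Implicit Types x y z s t v : E.

Definition meet x y : E :=
  proj1_sig (constructive_indefinite_description _ (lea_meet x y)).

Definition sharp x : Prop := meet x (compl x) = zero.

Definition is_least_sharp_above x s : Prop :=
  sharp s /\ le x s /\ forall v, sharp v -> le x v -> le s v.

Definition is_greatest_sharp_below x s : Prop :=
  sharp s /\ le s x /\ forall v, sharp v -> le v x -> le v s.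

Definition sharply_dominating : Prop :=
  forall x, exists s, is_least_sharp_above x s.

Definition meager x : Prop := forall v, sharp v -> le v x -> v = zero.

Definition S_oplus x y z : Prop := sharp x /\ sharp y /\ sharp z /\ oplus x y z.

Definition M_oplus x y z : Prop :=
  meager x /\ meager y /\ meager z /\ oplus x y z.

Definition M_ominus x y z : Prop := M_oplus y z x.

(* h s x: x is an element of the set h(s). *)
Definition h s x : Prop := meager x /\ le x s.

Definition S_set x y z : Prop := sharp z /\ oplus (meet z x) (meet z y) z.

(* S_map x y s: S(x,y) is defined and equals s. *)
Definition S_map x y s : Prop := S_set x y s /\ forall z, S_set x y z -> le z s.

Definition in_T (p : E * E) : Prop :=
  sharp (fst p) /\ meager (snd p) /\ h (compl (fst p)) (snd p).

Definition T : Type := {p : E * E | in_T p}.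

Definition pi_S (x : T) : E := fst (proj1_sig x).
Definition pi_M (x : T) : E := snd (proj1_sig x).

Definition T_oplus (x y z : T) : Prop :=
  exists s, S_map (pi_M x) (pi_M y) s /\
    (exists t, S_oplus (pi_S x) (pi_S y) t /\ S_oplus t s (pi_S z)) /\
    (exists u v, M_ominus (pi_M x) (meet s (pi_M x)) u /\
                 M_ominus (pi_M y) (meet s (pi_M y)) v /\
                 M_oplus u v (pi_M z)) /\
    h (compl (pi_S z)) (pi_M z).

End LatticeEffectAlgebra.

Section TConstants.
Variable E : lattice_effect_algebra.
Implicit Types x y z : E.

Let ax := effect_algebraP E.

Lemma oplus_compl x : oplus x (compl x) one.
Proof. unfold compl. now destruct (constructive_definite_description _ _). Qed.

Lemma meetP x y : is_meet x y (meet x y).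
Proof. unfold meet. now destruct (constructive_indefinite_description _ _). Qed.

Lemma compl_unique x y : oplus x y one -> compl x = y.
Proof.
  intros Hy. destruct (ea_compl ax x) as [w [_ Hw]].
  rewrite <- (Hw _ Hy). symmetry. apply Hw, oplus_compl.
Qed.

Lemma compl_one : compl one = (zero : E).
Proof. apply (ea_one ax). exists one. apply oplus_compl. Qed.

Lemma oplus_zero x : oplus x zero x.
Proof.
  assert (H1 : oplus one zero (one : E)).
  { rewrite <- compl_one. apply oplus_compl. }
  assert (H : exists u, oplus (compl x) x u /\ oplus u zero one).
  { exists one. split; [apply (ea_comm ax), oplus_compl | exact H1]. }
  apply (ea_assoc ax) in H. destruct H as [v [Hv H]].
  assert (v = x) as <-; [| exact Hv].
  rewrite <- (compl_unique H). apply compl_unique.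
  apply (ea_comm ax), oplus_compl.
Qed.

Lemma zero_le x : le zero x.
Proof. exists x. apply (ea_comm ax), oplus_zero. Qed.

Lemma le_zero x : le x zero -> x = zero.
Proof.
  intros [y Hy].
  assert (H : exists u, oplus y x u /\ oplus u one one).
  { exists zero. split; [now apply (ea_comm ax) |].
    apply (ea_comm ax), oplus_zero. }
  apply (ea_assoc ax) in H. destruct H as [v [Hv _]].
  apply (ea_one ax). exists v. now apply (ea_comm ax).
Qed.

Lemma compl_zero : compl zero = (one : E).
Proof. apply compl_unique. apply (ea_comm ax), oplus_zero. Qed.

Lemma sharp_zero : sharp (zero : E).
Proof. apply le_zero, meetP. Qed.

Lemma sharp_one : sharp (one : E).
Proof. unfold sharp. rewrite compl_one. apply le_zero, meetP. Qed.

Lemma meager_zero : meager (zero : E).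
Proof. intros v _. apply le_zero. Qed.

Lemma in_T_zero : in_T ((zero : E), (zero : E)).
Proof.
  repeat split; simpl; auto using sharp_zero, meager_zero, zero_le.
Qed.

Lemma in_T_one : in_T ((one : E), (zero : E)).
Proof.
  repeat split; simpl; auto using sharp_one, meager_zero, zero_le.
Qed.

Definition T_zero : T E := exist _ _ in_T_zero.
Definition T_one : T E := exist _ _ in_T_one.

End TConstants.

(* Main.v *)
Require Import Defs.
From Stdlib Require Import Classical ClassicalEpsilon Lia.

(** Every x is the sum of its greatest sharp part s and a meager remainder m,
    and this is its only decomposition into a sharp and a meager element:
    sharp elements are closed under sums and differences ([sharp_oplus],
    [sharp_ominus]), so a larger sharp part would leave a nonzero sharp element
    below m. Hence phi is a bijection, with inverse (s, m) |-> s + m, which is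
    defined on T(E) because m <= s'.

    It remains to see that phi respects the operations; the effect algebra
    axioms of T(E) then follow by transport. Suppose that x + y exists and let
    s be the greatest sharp element below w = x_M + y_M. Then
    x + y = (x_S + y_S + s) + (w - s) is again a sharp-meager decomposition,
    and it is the one prescribed by the operation of T(E) as soon as
    s = (s /\ x_M) + (s /\ y_M): the sum w dominates every sharp z that splits
    in this way, so s is then the top element S(x_M, y_M). Conversely the
    prescribed sums can be regrouped to x + y.

    The point is therefore that the greatest sharp element s below x + y splits
    as (s /\ x) + (s /\ y) ([greatest_sharp_below_oplus]). This says that s is
    compatible with x and with y, although in general neither of them need be
    compatible with all the atoms below s. It is obtained in the dual form
    [least_sharp_above_orthogonal]: if q is orthogonal to p and disjoint from
    the least sharp element v above p, then q is orthogonal to v. This is where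
    atomicity and the Archimedean property enter. *)

(** * Partial sums and order *)

Section EffectAlgebraOrder.
Variable E : lattice_effect_algebra.
Implicit Types x y z u v w a b c d : E.

Let ax := effect_algebraP E.

Lemma oplus_functional x y z z' : oplus x y z -> oplus x y z' -> z = z'.
Proof. apply (ea_functional ax). Qed.

Lemma oplus_comm x y z : oplus x y z -> oplus y x z.
Proof. apply (ea_comm ax). Qed.

Lemma oplus_assoc_r x y z u w :
  oplus x y u -> oplus u z w -> exists v, oplus y z v /\ oplus x v w.
Proof. intros H1 H2. apply (ea_assoc ax). eauto. Qed.

Lemma oplus_assoc_l x y z v w :
  oplus y z v -> oplus x v w -> exists u, oplus x y u /\ oplus u z w.
Proof. intros H1 H2. apply (ea_assoc ax). eauto. Qed.

(** The rearrangement (a + b) + (c + d) = (a + c) + (b + d), where all the sums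
    on the right exist as soon as those on the left do. Every regrouping of
    longer sums below is reduced to it. *)
Lemma oplus_interchange a b c d x y z :
  oplus a b x -> oplus c d y -> oplus x y z ->
  exists u v, oplus a c u /\ oplus b d v /\ oplus u v z.
Proof.
  intros Hab Hcd Hxy.
  destruct (oplus_assoc_r _ _ _ _ _ Hab Hxy) as [k [Hby Hak]].
  destruct (oplus_assoc_l _ _ _ _ _ Hcd Hby) as [m [Hbc Hmd]].
  destruct (oplus_assoc_r _ _ _ _ _ (oplus_comm _ _ _ Hbc) Hmd)
    as [v [Hbd Hcv]].
  destruct (oplus_assoc_l _ _ _ _ _ Hcv Hak) as [u [Hac Huv]].
  eauto 6.
Qed.

Lemma oplus_cancel x y z s : oplus x y s -> oplus x z s -> y = z.
Proof.
  intros Hy Hz.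
  destruct (oplus_assoc_r _ _ _ _ _ (oplus_comm _ _ _ Hy) (oplus_compl s))
    as [k [Hk Hyk]].
  destruct (oplus_assoc_r _ _ _ _ _ (oplus_comm _ _ _ Hz) (oplus_compl s))
    as [k' [Hk' Hzk]].
  rewrite <- (oplus_functional _ _ _ _ Hk Hk') in Hzk.
  rewrite <- (compl_unique (oplus_comm _ _ _ Hyk)).
  apply compl_unique, oplus_comm, Hzk.
Qed.

Lemma compl_compl x : compl (compl x) = x.
Proof. apply compl_unique, oplus_comm, oplus_compl. Qed.

Lemma le_refl x : le x x.
Proof. exists zero. apply oplus_zero. Qed.

Lemma le_trans y x z : le x y -> le y z -> le x z.
Proof.
  intros [a Ha] [b Hb]. destruct (oplus_assoc_r _ _ _ _ _ Ha Hb) as [v [_ Hv]].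
  now exists v.
Qed.

Lemma le_antisym x y : le x y -> le y x -> x = y.
Proof.
  intros [a Ha] [b Hb]. destruct (oplus_assoc_r _ _ _ _ _ Ha Hb) as [v [Hv Hx]].
  assert (v = zero) as -> by (eapply oplus_cancel; eauto using oplus_zero).
  assert (a = zero) as -> by (apply le_zero; now exists b).
  eapply oplus_functional; eauto using oplus_zero.
Qed.

Lemma le_oplus_l x y s : oplus x y s -> le x s.
Proof. now exists y. Qed.

Lemma le_oplus_r x y s : oplus x y s -> le y s.
Proof. exists x. now apply oplus_comm. Qed.

Lemma le_compl_iff_defined x y : le x (compl y) <-> defined (@oplus E) x y.
Proof.
  split.
  - intros [c Hc].
    destruct (oplus_assoc_l _ _ _ _ _ Hc (oplus_compl y)) as [s [Hs _]].
    exists s. now apply oplus_comm.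
  - intros [s Hs].
    destruct (oplus_assoc_r _ _ _ _ _ (oplus_comm _ _ _ Hs) (oplus_compl s))
      as [c [Hc Hyc]].
    rewrite (compl_unique Hyc). now exists (compl s).
Qed.

Lemma le_compl_sym x y : le x (compl y) -> le y (compl x).
Proof.
  rewrite !le_compl_iff_defined. intros [s Hs]. exists s. now apply oplus_comm.
Qed.

Lemma le_compl x y : le x y -> le (compl y) (compl x).
Proof. intros H. apply le_compl_sym. now rewrite compl_compl. Qed.

Lemma oplus_defined_le x y a s :
  le a x -> oplus x y s -> exists t, oplus a y t /\ le t s.
Proof.
  intros [b Hb] Hs.
  destruct (oplus_assoc_r _ _ _ _ _ (oplus_comm _ _ _ Hb) Hs) as [t [Ht H]].
  exists t. split; [exact Ht | exact (le_oplus_r _ _ _ H)].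
Qed.

Lemma oplus_le a b x y s t :
  le a x -> le b y -> oplus a b s -> oplus x y t -> le s t.
Proof.
  intros Ha Hb Hs Ht.
  destruct (oplus_defined_le _ _ _ _ Ha Ht) as [r [Hr Hrt]].
  destruct (oplus_defined_le _ _ _ _ Hb (oplus_comm _ _ _ Hr)) as [s' [Hs' Hsr]].
  rewrite (oplus_functional _ _ _ _ Hs (oplus_comm _ _ _ Hs')).
  exact (le_trans _ _ _ Hsr Hrt).
Qed.

Lemma oplus_le_cancel x a b s t : oplus x a s -> oplus x b t -> le s t -> le a b.
Proof.
  intros Ha Hb [c Hc].
  destruct (oplus_assoc_r _ _ _ _ _ Ha Hc) as [d [Hd Hxd]].
  rewrite (oplus_cancel _ _ _ _ Hb Hxd). now exists c.
Qed.

Lemma oplus_eq_zero_r x y : oplus x y x -> y = zero.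
Proof. intros H. exact (oplus_cancel _ _ _ _ H (oplus_zero x)). Qed.

End EffectAlgebraOrder.

Arguments oplus_functional {E x y z z'}.
Arguments oplus_comm {E x y z}.
Arguments oplus_assoc_r {E x y z u w}.
Arguments oplus_assoc_l {E x y z v w}.
Arguments oplus_interchange {E a b c d x y z}.
Arguments oplus_cancel {E x y z s}.
Arguments le_trans {E} y {x z}.
Arguments le_antisym {E x y}.
Arguments le_oplus_l {E x y s}.
Arguments le_oplus_r {E x y s}.
Arguments le_compl_sym {E x y}.
Arguments le_compl {E x y}.
Arguments oplus_defined_le {E x y a s}.
Arguments oplus_le {E a b x y s t}.
Arguments oplus_le_cancel {E x a b s t}.
Arguments oplus_eq_zero_r {E x y}.

(** * Disjoint sums and sharp elements *)

Section SharpElements.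
Variable E : lattice_effect_algebra.
Implicit Types x y z u v w s t a b c m p q : E.

Lemma meet_le_l x y : le (meet x y) x.
Proof. apply meetP. Qed.

Lemma meet_le_r x y : le (meet x y) y.
Proof. apply meetP. Qed.

Lemma le_meet z x y : le z x -> le z y -> le z (meet x y).
Proof. apply meetP. Qed.

Lemma meet_eq_zero x y : (forall z, le z x -> le z y -> z = zero) -> meet x y = zero.
Proof. intros H. apply H; [apply meet_le_l | apply meet_le_r]. Qed.

Lemma le_of_meet_eq_zero x y z : meet x y = zero -> le z x -> le z y -> z = zero.
Proof. intros H Hx Hy. apply le_zero. rewrite <- H. now apply le_meet. Qed.

(** If j is the join then (x + y) - j lies below both x and y, by cancelling y
    and x in turn; so it vanishes when x and y are disjoint. *)
Lemma disjoint_oplus_is_join x y s :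
  oplus x y s -> meet x y = zero -> is_join x y s.
Proof.
  intros Hs H0. destruct (lea_join x y) as [j Hj].
  enough (j = s) as <- by exact Hj.
  destruct Hj as [[c Hc] [[d Hd] Hj]].
  destruct (Hj s (le_oplus_l Hs) (le_oplus_r Hs)) as [e He].
  destruct (oplus_assoc_r Hc He) as [y' [Hce Hxy]].
  destruct (oplus_assoc_r Hd He) as [x' [Hde Hyx]].
  rewrite (oplus_cancel Hxy Hs) in Hce.
  rewrite (oplus_cancel Hyx (oplus_comm Hs)) in Hde.
  rewrite (le_of_meet_eq_zero _ _ _ H0 (le_oplus_r Hde) (le_oplus_r Hce)) in He.
  exact (oplus_functional (oplus_zero j) He).
Qed.

(** Sharp elements are principal. Since v is disjoint from z', the sum v + z'
    is a join, and both v and z' lie below u'; hence u + v + z' exists. *)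
Lemma sharp_oplus_le z u v s :
  sharp z -> le u z -> le v z -> oplus u v s -> le s z.
Proof.
  intros Hz Hu Hv Hs.
  assert (Hk : defined (@oplus E) v (compl z)).
  { apply le_compl_iff_defined. now rewrite compl_compl. }
  destruct Hk as [k Hk].
  assert (Hj : is_join v (compl z) k).
  { apply disjoint_oplus_is_join; [exact Hk |]. apply meet_eq_zero.
    intros c Hcv Hcz.
    exact (le_of_meet_eq_zero _ _ _ Hz (le_trans v Hcv Hv) Hcz). }
  assert (Hku : le k (compl u)).
  { apply Hj; [| now apply le_compl].
    apply le_compl_iff_defined. exists s. now apply oplus_comm. }
  apply le_compl_iff_defined in Hku. destruct Hku as [r Hr].
  destruct (oplus_assoc_l Hk (oplus_comm Hr)) as [s' [Hs' H]].
  rewrite (oplus_functional Hs' Hs) in H.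
  rewrite <- (compl_compl E z). apply le_compl_iff_defined. now exists r.
Qed.

Lemma sharp_compl z : sharp z -> sharp (compl z).
Proof.
  intros Hz. apply meet_eq_zero. intros c Hc. rewrite compl_compl.
  intros Hcz. exact (le_of_meet_eq_zero _ _ _ Hz Hcz Hc).
Qed.

(** If t lies below both u + v and its complement, then t is orthogonal to u
    and so disjoint from it; hence t + u is a join below u + v, and cancelling
    u gives t <= v, whereas t <= v'. *)
Lemma sharp_oplus u v s : sharp u -> sharp v -> oplus u v s -> sharp s.
Proof.
  intros Hu Hv Hs. apply meet_eq_zero. intros t Hts Hts'.
  assert (Htu : le t (compl u)).
  { exact (le_trans _ Hts' (le_compl (le_oplus_l Hs))). }
  assert (Htv : le t (compl v)).
  { exact (le_trans _ Hts' (le_compl (le_oplus_r Hs))). }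
  destruct (proj1 (le_compl_iff_defined _ _ _) Htu) as [j Hj].
  assert (Hjs : le j s).
  { apply (disjoint_oplus_is_join t u j Hj); [| exact Hts | exact (le_oplus_l Hs)].
    apply meet_eq_zero. intros c Hct Hcu.
    exact (le_of_meet_eq_zero _ _ _ Hu Hcu (le_trans t Hct Htu)). }
  apply (le_of_meet_eq_zero _ _ _ Hv); [| exact Htv].
  exact (oplus_le_cancel (oplus_comm Hj) Hs Hjs).
Qed.

Lemma sharp_ominus u v d : sharp u -> sharp v -> oplus v d u -> sharp d.
Proof.
  intros Hu Hv Hd.
  (* d = (v + u')' *)
  destruct (oplus_assoc_r (oplus_comm Hd) (oplus_compl u)) as [k [Hk Hdk]].
  rewrite <- (compl_unique (oplus_comm Hdk)).
  apply sharp_compl. exact (sharp_oplus _ _ _ Hv (sharp_compl _ Hu) Hk).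
Qed.

Lemma meager_le x y : meager y -> le x y -> meager x.
Proof. intros Hy Hxy v Hv Hvx. exact (Hy v Hv (le_trans x Hvx Hxy)). Qed.

Lemma least_sharp_above_compl x s :
  is_least_sharp_above (compl x) s -> is_greatest_sharp_below x (compl s).
Proof.
  intros [Hs [Hxs Hmin]]. split; [now apply sharp_compl | split].
  - apply le_compl in Hxs. now rewrite compl_compl in Hxs.
  - intros v Hv Hvx. apply le_compl_sym, Hmin; [now apply sharp_compl |].
    now apply le_compl.
Qed.

Lemma greatest_sharp_below_compl x s :
  is_greatest_sharp_below x s -> is_least_sharp_above (compl x) (compl s).
Proof.
  intros [Hs [Hsx Hmax]]. split; [now apply sharp_compl | split].
  - now apply le_compl.
  - intros v Hv Hxv. rewrite <- (compl_compl E v). apply le_compl, Hmax.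
    + now apply sharp_compl.
    + apply le_compl in Hxv. now rewrite compl_compl in Hxv.
Qed.

(** A nonzero sharp element below m could be added to s. *)
Lemma meager_of_greatest_sharp_below x s m :
  is_greatest_sharp_below x s -> oplus s m x -> meager m.
Proof.
  intros [Hs [_ Hmax]] Hm v Hv [r Hr].
  destruct (oplus_assoc_l Hr Hm) as [t [Ht Htx]].
  assert (Hts : le t s).
  { apply Hmax; [exact (sharp_oplus _ _ _ Hs Hv Ht) | exact (le_oplus_l Htx)]. }
  rewrite (le_antisym Hts (le_oplus_l Ht)) in Ht.
  exact (oplus_eq_zero_r Ht).
Qed.

(** * Multiples of an atom *)

(** Adding a to such an element c is taking a join, so c + a is still below
    (k + 1) a whenever c is; cancelling a brings c down to k a. *)
Lemma disjoint_le_multiple_eq_zero a k y c :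
  multiple a k y -> meet c a = zero -> le c (compl a) -> le c y -> c = zero.
Proof.
  intros Hy Hca Hc. induction Hy as [| k y z Hy IH Hz]; intros Hcy.
  - exact (le_of_meet_eq_zero _ _ _ Hca (le_refl _ c) Hcy).
  - apply IH. destruct (proj1 (le_compl_iff_defined _ _ _) Hc) as [j Hj].
    apply (oplus_le_cancel (oplus_comm Hj) (oplus_comm Hz)).
    apply (disjoint_oplus_is_join _ _ _ Hj Hca); [exact Hcy |].
    exact (le_oplus_r Hz).
Qed.

(** Since c is disjoint from k a, the sum c + k a is a join of two elements
    orthogonal to a; hence a can be added once more. *)
Lemma disjoint_le_compl_multiple a k y c :
  multiple a k y -> meet c a = zero -> le c (compl a) -> le c (compl y).
Proof.
  intros Hy Hca Hc. induction Hy as [| k y z Hy IH Hz]; [exact Hc |].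
  destruct (proj1 (le_compl_iff_defined _ _ _) IH) as [j Hj].
  assert (Hcy : meet c y = zero).
  { apply meet_eq_zero. intros d Hdc Hdy.
    apply (disjoint_le_multiple_eq_zero _ _ _ _ Hy); [| | exact Hdy].
    - apply meet_eq_zero. intros e Hed Hea.
      exact (le_of_meet_eq_zero _ _ _ Hca (le_trans d Hed Hdc) Hea).
    - exact (le_trans c Hdc Hc). }
  assert (Hja : le j (compl a)).
  { apply (disjoint_oplus_is_join _ _ _ Hj Hcy); [exact Hc |].
    apply le_compl_iff_defined. now exists z. }
  apply le_compl_iff_defined in Hja. destruct Hja as [r Hr].
  destruct (oplus_assoc_r Hj Hr) as [z' [Hz' H]].
  rewrite (oplus_functional Hz' Hz) in H.
  apply le_compl_iff_defined. now exists r.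
Qed.

Lemma atom_meet_eq_zero a c : atom a -> ~ le a c -> meet c a = zero.
Proof.
  intros [_ Ha] Hac. apply meet_eq_zero. intros z Hzc Hza.
  apply NNPP. intros Hz. apply Hac. now rewrite <- (Ha z Hz Hza).
Qed.

(** An element orthogonal to ord(a) a does not dominate a, since ord(a) + 1
    copies of a cannot be added; so it is disjoint from a, and from all
    multiples of a. *)
Lemma sharp_multiple_ord a k y :
  atom a -> has_finite_ord a k -> multiple a k y -> sharp y.
Proof.
  intros Ha [_ Hk] Hy. apply meet_eq_zero. intros c Hcy Hcy'.
  assert (Hac : ~ le a c).
  { intros Hac. assert (H : le a (compl y)) by exact (le_trans c Hac Hcy').
    apply le_compl_iff_defined in H. destruct H as [z Hz].
    assert (S k <= k); [| lia].
    apply Hk. exists z. apply (multiple_succ Hy). now apply oplus_comm. }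
  apply (disjoint_le_multiple_eq_zero _ _ _ _ Hy); [| | exact Hcy].
  - now apply atom_meet_eq_zero.
  - apply (le_trans _ Hcy'), le_compl. clear - Hy.
    destruct Hy as [| k y z Hy Hz]; [apply le_refl | exact (le_oplus_r Hz)].
Qed.

(** * Splitting along the greatest sharp element *)

Section Orthogonality.
Hypothesis E_atomic : atomic E.
Hypothesis E_archimedean : archimedean E.

(** The sharp cover v of p inherits orthogonality to q, provided that q is
    disjoint from v. In an MV-algebra v would be the supremum of the truncated
    multiples of p, obtained by iterating c |-> c + (p /\ c'); orthogonality to
    q passes from c to the next one because q + c is a join. If the part u of v
    that is orthogonal to q were not all of v, take an atom a below v - u. When
    a <= p, all truncated multiples c of p stay below u and the n-th one
    dominates n a, against the Archimedean property. Otherwise a is disjoint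
    from p, so p lies below the sharp element (ord(a) a)', and so do v and a,
    against the choice of ord(a). *)
Lemma least_sharp_above_orthogonal p v q :
  is_least_sharp_above p v -> le q (compl p) -> meet q v = zero ->
  le q (compl v).
Proof.
  intros [Hv [Hpv Hmin]] Hqp Hqv.
  set (u := meet v (compl q)).
  assert (Hpu : le p u) by (apply le_meet; [exact Hpv | now apply le_compl_sym]).
  destruct (meet_le_l v (compl q) : le u v) as [d Hd].
  destruct (classic (d = zero)) as [-> | Hd0].
  { apply le_compl_sym. rewrite <- (oplus_functional (oplus_zero u) Hd).
    apply meet_le_r. }
  exfalso. destruct (E_atomic d Hd0) as [a [Ha Had]].
  destruct (oplus_defined_le Had (oplus_comm Hd)) as [ua [Hua Huav]].
  assert (Hau : le a (compl u)) by (apply le_compl_iff_defined; now exists ua).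
  destruct (E_archimedean a (proj1 Ha)) as [k Hk].
  destruct (classic (le a p)) as [Hap | Hap].
  - (* c is a truncated multiple of p; the next one is e = c + (p /\ c') *)
    assert (Hall : forall n, exists c y,
      multiple a (S n) y /\ le y c /\ le c u).
    { induction n as [| n [c [y [Hy [Hyc Hcu]]]]].
      - exists p, a. repeat split; [constructor | exact Hap | exact Hpu].
      - assert (Hc : le (meet p (compl c)) (compl c)) by apply meet_le_r.
        apply le_compl_iff_defined in Hc. destruct Hc as [e He].
        apply oplus_comm in He.
        assert (Hac : le a (meet p (compl c))).
        { apply le_meet; [exact Hap |].
          exact (le_trans _ Hau (le_compl Hcu)). }
        assert (Hay : le a (compl y)).
        { apply (le_trans (compl c)); [| now apply le_compl].
          exact (le_trans _ Hac (meet_le_r _ _)). }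
        apply le_compl_iff_defined in Hay. destruct Hay as [y' Hy'].
        apply oplus_comm in Hy'.
        exists e, y'. split; [exact (multiple_succ Hy Hy') | split].
        + exact (oplus_le Hyc Hac Hy' He).
        + apply le_meet.
          * apply (sharp_oplus_le _ _ _ _ Hv) with (3 := He).
            -- exact (le_trans u Hcu (meet_le_l _ _)).
            -- exact (le_trans p (meet_le_l _ _) Hpv).
          * (* q + c is a join, and both q and c are orthogonal to p /\ c' *)
            assert (Hcq : defined (@oplus E) q c).
            { apply le_compl_iff_defined, le_compl_sym.
              exact (le_trans u Hcu (meet_le_r _ _)). }
            destruct Hcq as [j Hj].
            assert (Hje : le j (compl (meet p (compl c)))).
            { apply (disjoint_oplus_is_join _ _ _ Hj).
              - apply meet_eq_zero. intros f Hfq Hfc.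
                apply (le_of_meet_eq_zero _ _ _ Hqv Hfq).
                exact (le_trans c Hfc (le_trans u Hcu (meet_le_l _ _))).
              - exact (le_trans _ Hqp (le_compl (meet_le_l _ _))).
              - apply le_compl_sym, meet_le_r. }
            apply le_compl_iff_defined in Hje. destruct Hje as [g Hg].
            destruct (oplus_assoc_r Hj Hg) as [e' [He' H]].
            rewrite (oplus_functional He' He) in H.
            apply le_compl_iff_defined. exists g. now apply oplus_comm. }
    destruct (Hall k) as [c [y [Hy _]]]. assert (S k <= k); [| lia].
    apply (proj2 Hk). now exists y.
  - destruct (proj1 Hk) as [y Hy].
    assert (Hpy : le p (compl y)).
    { apply (disjoint_le_compl_multiple _ _ _ _ Hy).
      - now apply atom_meet_eq_zero.
      - apply le_compl_sym. exact (le_trans _ Hau (le_compl Hpu)). }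
    assert (Hvy : le v (compl y)).
    { apply Hmin; [| exact Hpy].
      exact (sharp_compl _ (sharp_multiple_ord _ _ _ Ha Hk Hy)). }
    assert (Hay : le a (compl y)).
    { apply (le_trans v); [| exact Hvy]. exact (le_trans _ (le_oplus_l Hua) Huav). }
    apply le_compl_iff_defined in Hay. destruct Hay as [z Hz].
    assert (S k <= k); [| lia].
    apply (proj2 Hk). exists z. apply (multiple_succ Hy). now apply oplus_comm.
Qed.

(** The greatest sharp element z below w splits every x <= w. The remainder q
    of x over x /\ z' is disjoint from the sharp element z', which is the least
    one above w', and q is orthogonal to w'; so q is orthogonal to z'. *)
Lemma greatest_sharp_below_splits w z x :
  is_greatest_sharp_below w z -> le x w ->
  oplus (meet z x) (meet (compl z) x) x.
Proof.
  intros Hz Hxw. pose proof (greatest_sharp_below_compl _ _ Hz) as Hv.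
  set (v := compl z) in *.
  destruct (meet_le_r v x) as [q Hq].
  assert (Hqv : meet q v = zero).
  { apply meet_eq_zero. intros c Hcq Hcv.
    destruct (oplus_defined_le Hcq (oplus_comm Hq)) as [t [Ht Htx]].
    assert (Htv : le t v).
    { exact (sharp_oplus_le _ _ _ _ (proj1 Hv) Hcv (meet_le_l _ _) Ht). }
    pose proof (le_meet _ _ _ Htv Htx) as H.
    rewrite (le_antisym H (le_oplus_r Ht)) in Ht.
    exact (oplus_eq_zero_r (oplus_comm Ht)). }
  assert (Hqz : le q z).
  { rewrite <- (compl_compl E z).
    apply (least_sharp_above_orthogonal _ _ _ Hv); [| exact Hqv].
    rewrite compl_compl. exact (le_trans x (le_oplus_r Hq) Hxw). }
  enough (meet z x = q) as -> by now apply oplus_comm.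
  apply le_antisym.
  - (* z /\ x is orthogonal and disjoint to v /\ x, so their join is below x *)
    assert (Ho : le (meet v x) (compl (meet z x))).
    { exact (le_trans v (meet_le_l _ _) (le_compl (meet_le_l _ _))). }
    apply le_compl_iff_defined in Ho. destruct Ho as [j Hj].
    apply (oplus_le_cancel Hj Hq).
    apply (disjoint_oplus_is_join _ _ _ Hj); [| apply meet_le_r | apply meet_le_r].
    apply meet_eq_zero. intros c Hcv Hcz.
    apply (le_of_meet_eq_zero _ _ _ (proj1 Hz)).
    + exact (le_trans _ Hcz (meet_le_l _ _)).
    + exact (le_trans _ Hcv (meet_le_l _ _)).
  - apply le_meet; [exact Hqz | exact (le_oplus_r Hq)].
Qed.

(** Splitting x and y along z and regrouping writes w = B + A with B <= z <= w
    and A <= z'; then z - B lies below both z and A, so it vanishes. *)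
Lemma greatest_sharp_below_oplus x y w z :
  oplus x y w -> is_greatest_sharp_below w z -> oplus (meet z x) (meet z y) z.
Proof.
  intros Hw Hz.
  pose proof (greatest_sharp_below_splits _ _ _ Hz (le_oplus_l Hw)) as Hx.
  pose proof (greatest_sharp_below_splits _ _ _ Hz (le_oplus_r Hw)) as Hy.
  destruct (oplus_interchange Hx Hy Hw) as [B [A [HB [HA HBA]]]].
  destruct Hz as [Hz [[r Hr] _]].
  destruct (sharp_oplus_le _ _ _ _ Hz (meet_le_l _ _) (meet_le_l _ _) HB) as [c Hc].
  assert (HAz : le A (compl z)).
  { apply (sharp_oplus_le _ _ _ _ (sharp_compl _ Hz)) with (3 := HA);
      apply meet_le_l. }
  destruct (oplus_assoc_r Hc Hr) as [A' [HA' H]].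
  rewrite (oplus_cancel H HBA) in HA'.
  assert (c = zero) as ->.
  { apply (le_of_meet_eq_zero _ _ _ Hz); [exact (le_oplus_r Hc) |].
    exact (le_trans A (le_oplus_l HA') HAz). }
  now rewrite (oplus_functional (oplus_zero B) Hc) in HB.
Qed.

Lemma S_map_greatest_sharp_below x y w s :
  oplus x y w -> is_greatest_sharp_below w s -> S_map x y s.
Proof.
  intros Hw Hs. split; [split |].
  - apply Hs.
  - exact (greatest_sharp_below_oplus _ _ _ _ Hw Hs).
  - intros z [Hz Hzxy]. apply Hs; [exact Hz |].
    exact (oplus_le (meet_le_r _ _) (meet_le_r _ _) Hzxy Hw).
Qed.

End Orthogonality.

(** * Sharp-meager decompositions *)

Section Decomposition.
Hypothesis E_sharply_dominating : sharply_dominating E.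

Lemma exists_greatest_sharp_below x : exists s, is_greatest_sharp_below x s.
Proof.
  destruct (E_sharply_dominating (compl x)) as [s Hs].
  exists (compl s). now apply least_sharp_above_compl.
Qed.

(** The sharp part of x exceeds s by a sharp element, and by cancellation this
    element lies below m; so it vanishes. *)
Lemma greatest_sharp_below_of_meager x s m :
  sharp s -> meager m -> oplus s m x -> is_greatest_sharp_below x s.
Proof.
  intros Hs Hm Hx. destruct (exists_greatest_sharp_below x) as [t Ht].
  enough (t = s) as <- by exact Ht.
  destruct Ht as [Ht [Htx Hmax]].
  destruct (Hmax s Hs (le_oplus_l Hx)) as [d Hd].
  assert (d = zero) as ->.
  { apply Hm; [exact (sharp_ominus _ _ _ Ht Hs Hd) |].
    exact (oplus_le_cancel Hd Hx Htx). }
  exact (oplus_functional Hd (oplus_zero s)).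
Qed.

Lemma sharp_meager_unique x s m s' m' :
  sharp s -> meager m -> oplus s m x ->
  sharp s' -> meager m' -> oplus s' m' x -> s = s' /\ m = m'.
Proof.
  intros Hs Hm Hx Hs' Hm' Hx'.
  destruct (greatest_sharp_below_of_meager _ _ _ Hs Hm Hx) as [_ [H1 H2]].
  destruct (greatest_sharp_below_of_meager _ _ _ Hs' Hm' Hx') as [_ [H3 H4]].
  assert (s = s') as <- by (apply le_antisym; [apply H4 | apply H2]; assumption).
  split; [reflexivity | exact (oplus_cancel Hx Hx')].
Qed.

(** The converse of this relation is the graph of phi. *)
Definition recomposes (t : T E) x : Prop := oplus (pi_S t) (pi_M t) x.

Lemma pi_S_sharp (t : T E) : sharp (pi_S t).
Proof. exact (proj1 (proj2_sig t)). Qed.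

Lemma pi_M_meager (t : T E) : meager (pi_M t).
Proof. exact (proj1 (proj2 (proj2_sig t))). Qed.

Lemma T_ext (t t' : T E) : pi_S t = pi_S t' -> pi_M t = pi_M t' -> t = t'.
Proof.
  destruct t as [[s m] Ht], t' as [[s' m'] Ht']. unfold pi_S, pi_M; simpl.
  intros -> ->. f_equal. apply proof_irrelevance.
Qed.

Lemma recomposes_inj (t t' : T E) x : recomposes t x -> recomposes t' x -> t = t'.
Proof.
  intros H H'.
  destruct (sharp_meager_unique _ _ _ _ _ (pi_S_sharp t) (pi_M_meager t) H
              (pi_S_sharp t') (pi_M_meager t') H').
  now apply T_ext.
Qed.

Lemma exists_recomposition (t : T E) : exists x, recomposes t x.
Proof.
  destruct (proj2 (proj2 (proj2 (proj2_sig t)))) as [c Hc].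
  assert (H : le (pi_M t) (compl (pi_S t))) by now exists c.
  apply le_compl_iff_defined in H. destruct H as [x Hx].
  exists x. now apply oplus_comm.
Qed.

Lemma exists_decomposition x :
  exists t : T E, is_greatest_sharp_below x (pi_S t) /\ recomposes t x.
Proof.
  destruct (exists_greatest_sharp_below x) as [s Hs].
  destruct (proj1 (proj2 Hs)) as [m Hm].
  pose proof (meager_of_greatest_sharp_below _ _ _ Hs Hm) as Hmm.
  assert (Ht : in_T (s, m)).
  { split; [apply Hs | split; [exact Hmm | split; [exact Hmm |]]].
    apply le_compl_iff_defined. exists x. now apply oplus_comm. }
  exists (exist _ (s, m) Ht). now split.
Qed.

Hypothesis E_atomic : atomic E.
Hypothesis E_archimedean : archimedean E.

(** Both directions regroup the same sum. In the forward direction the sharp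
    part s of w = x_M + y_M is S(x_M, y_M) and splits between x_M and y_M, so
    that x + y = (x_S + y_S + s) + (w - s) is the sharp-meager decomposition. *)
Lemma oplus_iff_T_oplus (tx ty tz : T E) x y z :
  recomposes tx x -> recomposes ty y -> recomposes tz z ->
  (oplus x y z <-> T_oplus tx ty tz).
Proof.
  unfold recomposes. intros Hx Hy Hz. split.
  - intros Hxy.
    destruct (oplus_interchange Hx Hy Hxy) as [t [w [Ht [Hw Htw]]]].
    destruct (exists_greatest_sharp_below w) as [s Hs].
    destruct (proj1 (proj2 Hs)) as [r Hr].
    destruct (oplus_assoc_l Hr Htw) as [zS [HzS HzSr]].
    assert (Hts : sharp t).
    { exact (sharp_oplus _ _ _ (pi_S_sharp tx) (pi_S_sharp ty) Ht). }
    assert (HzSs : sharp zS) by exact (sharp_oplus _ _ _ Hts (proj1 Hs) HzS).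
    pose proof (meager_of_greatest_sharp_below _ _ _ Hs Hr) as Hrm.
    destruct (sharp_meager_unique _ _ _ _ _ HzSs Hrm HzSr
                (pi_S_sharp tz) (pi_M_meager tz) Hz) as [-> ->].
    destruct (meet_le_r s (pi_M tx)) as [u Hu].
    destruct (meet_le_r s (pi_M ty)) as [v Hv].
    destruct (oplus_interchange Hu Hv Hw) as [s' [r' [Hs' [Hr' H]]]].
    pose proof (greatest_sharp_below_oplus E_atomic E_archimedean _ _ _ _ Hw Hs)
      as Hss.
    rewrite (oplus_functional Hs' Hss) in H.
    rewrite (oplus_cancel H Hr) in Hr'.
    pose proof (pi_M_meager tx). pose proof (pi_M_meager ty).
    exists s. split; [| split; [| split]].
    + exact (S_map_greatest_sharp_below E_atomic E_archimedean _ _ _ _ Hw Hs).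
    + exists t. pose proof (proj1 Hs). unfold S_oplus.
      auto 10 using pi_S_sharp.
    + exists u, v. unfold M_ominus, M_oplus.
      repeat split; eauto using meager_le, meet_le_r, le_oplus_l, le_oplus_r.
    + exact (proj2 (proj2 (proj2_sig tz))).
  - intros [s [[[_ Hs] _] [[t [[_ [_ [_ Ht]]] [_ [_ [_ HzS]]]]] [H _]]]].
    destruct H as [u [v [[_ [_ [_ Hu]]] [[_ [_ [_ Hv]]] [_ [_ [_ Huv]]]]]]].
    destruct (oplus_interchange Ht Hs HzS) as [k [l [Hk [Hl Hkl]]]].
    destruct (oplus_interchange Hkl Huv Hz) as [x' [y' [Hx' [Hy' H]]]].
    destruct (oplus_assoc_r Hk Hx') as [xM [HxM Hxx]].
    destruct (oplus_assoc_r Hl Hy') as [yM [HyM Hyy]].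
    rewrite (oplus_functional HxM Hu) in Hxx.
    rewrite (oplus_functional HyM Hv) in Hyy.
    now rewrite (oplus_functional Hx Hxx), (oplus_functional Hy Hyy).
Qed.

End Decomposition.
End SharpElements.

(** * Transport of structure *)

Lemma effect_algebra_transport (A B : Type) (opA : A -> A -> A -> Prop) (oA iA : A)
    (opB : B -> B -> B -> Prop) (f : A -> B) :
  is_effect_algebra opA oA iA -> Bijective f ->
  (forall x y z, opA x y z <-> opB (f x) (f y) (f z)) ->
  is_effect_algebra opB (f oA) (f iA).
Proof.
  intros HA [g [Hgf Hfg]] Hop.
  assert (HB : forall s t u, opB s t u <-> opA (g s) (g t) (g u)).
  { intros s t u. rewrite Hop, !Hfg. reflexivity. }
  split.
  - intros s t u u' Hu Hu'. rewrite <- (Hfg u), <- (Hfg u'). f_equal.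
    apply HB in Hu, Hu'. exact (ea_functional HA Hu Hu').
  - intros H. apply (ea_nontrivial HA).
    now rewrite <- (Hgf oA), <- (Hgf iA), H.
  - intros s t u Hu. apply HB in Hu. apply HB. exact (ea_comm HA Hu).
  - intros s t u w. split; intros [k [H1 H2]]; apply HB in H1, H2.
    + destruct (proj1 (ea_assoc HA _ _ _ _) (ex_intro _ _ (conj H1 H2)))
        as [l [H3 H4]].
      exists (f l). rewrite !HB, Hgf. now split.
    + destruct (proj2 (ea_assoc HA _ _ _ _) (ex_intro _ _ (conj H1 H2)))
        as [l [H3 H4]].
      exists (f l). rewrite !HB, Hgf. now split.
  - intros s. destruct (ea_compl HA (g s)) as [y [Hy Hu]].
    exists (f y). split.
    + rewrite HB, !Hgf. exact Hy.
    + intros t Ht. apply HB in Ht. rewrite Hgf in Ht.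
      now rewrite (Hu _ Ht), Hfg.
  - intros s [u Hu]. apply HB in Hu. rewrite Hgf in Hu.
    rewrite <- (Hfg s). f_equal. apply (ea_one HA). now exists (g u).
Qed.

Theorem theorem3p2 :
  forall E : lattice_effect_algebra,
    sharply_dominating E -> atomic E -> archimedean E ->
    is_effect_algebra (@T_oplus E) (T_zero E) (T_one E) /\
    exists phi : E -> T E,
      (forall x : E,
         is_greatest_sharp_below x (pi_S (phi x)) /\
         ominus x (pi_S (phi x)) (pi_M (phi x))) /\
      is_ea_isomorphism (@oplus E) zero one
        (@T_oplus E) (T_zero E) (T_one E) phi.
Proof.
  intros E Hsd Hat Har.
  set (phi x := proj1_sig (constructive_indefinite_description _
                  (exists_decomposition E Hsd x))).
  assert (Hphi : forall x, is_greatest_sharp_below x (pi_S (phi x)) /\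
                           recomposes E (phi x) x).
  { intros x. exact (proj2_sig (constructive_indefinite_description _
                       (exists_decomposition E Hsd x))). }
  clearbody phi.
  assert (Hphi_eq : forall t x, recomposes E t x -> phi x = t).
  { intros t x Ht. exact (recomposes_inj E Hsd _ _ _ (proj2 (Hphi x)) Ht). }
  assert (Hbij : Bijective phi).
  { set (psi t := proj1_sig (constructive_indefinite_description _
                    (exists_recomposition E t))).
    assert (Hpsi : forall t, recomposes E t (psi t)).
    { intros t. exact (proj2_sig (constructive_indefinite_description _
                         (exists_recomposition E t))). }
    exists psi. split.
    - intros x. exact (oplus_functional (Hpsi (phi x)) (proj2 (Hphi x))).
    - intros t. apply Hphi_eq, Hpsi. }
  assert (Hzero : phi zero = T_zero E) by apply Hphi_eq, oplus_zero.
  assert (Hone : phi one = T_one E) by apply Hphi_eq, oplus_zero.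
  assert (Hop : forall x y z, oplus x y z <-> T_oplus (phi x) (phi y) (phi z)).
  { intros x y z. apply (oplus_iff_T_oplus E Hsd Hat Har); apply Hphi. }
  split.
  - rewrite <- Hzero, <- Hone.
    exact (effect_algebra_transport _ _ _ _ _ _ _ (effect_algebraP E) Hbij Hop).
  - exists phi. split; [exact Hphi |].
    split; [exact Hbij | split; [exact Hzero | split; [exact Hone | split]]].
    + intros x y. split.
      * intros [z Hz]. exists (phi z). now apply Hop.
      * intros [t Ht]. destruct Hbij as [psi [_ Hpsi]].
        exists (psi t). apply Hop. now rewrite Hpsi.
    + intros x y z. apply Hop.
Qed.
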